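(* (a) Let $X\subseteq\mathbb{R}$ be r.e. open. Every continuous and effectively open $f:X\to\mathbb{R}$ is computable. (b) Let $X\subseteq\mathbb{R}^n$ be r.e. open and $f=(f_1,\dots,f_m):X\to\mathbb{R}^m$ continuous and effectively open but not computable. Then some component $f_i:X\to\mathbb{R}$ is continuous and effectively open but not computable.
   Context: Type-2 computability (Weihrauch) with Cauchy representation for real vectors; $\theta^d_<$ represents open subsets of $\mathbb{R}^d$ by lists of rational centers and radii of open balls with union the set; $X$ r.e. open means it has a computable $\theta^n_<$-name. An open $f$ on $X$ is effectively open if $U\mapsto f[U]$ on open $U\subseteq X$ is $(\theta^n_<\to\theta^m_<)$-computable. *)

(* Defs.v *)
From Stdlib Require Import Reals QArith Qreals List.
From mathcomp Require Import ssreflect ssrbool ssrnat eqtype seq fintype.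
Open Scope nat_scope.

(* 1. Partial recursive functions (mu-recursive codes, relational
      big-step semantics).  Arities are handled loosely (missing
      arguments read as 0), which does not leave the class of
      partial recursive functions. *)
Inductive code : Type :=
| cZero : code
| cSucc : code
| cProj : nat -> code
| cComp : code -> list code -> code
| cRec  : code -> code -> code
| cMu   : code -> code.

Inductive eval : code -> list nat -> nat -> Prop :=
| eZero v : eval cZero v 0%nat
| eSucc v : eval cSucc v (S (List.hd 0%nat v))
| eProj i v : eval (cProj i) v (List.nth i v 0%nat)
| eComp f gs v ws y : evals gs v ws -> eval f ws y -> eval (cComp f gs) v y
| eRec0 f g v y : eval f v y -> eval (cRec f g) (0%nat :: v) y
| eRecS f g n v y z :
    eval (cRec f g) (n :: v) y -> eval g (n :: y :: v) z ->
    eval (cRec f g) (S n :: v) z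
| eMu f v n :
    eval f (n :: v) 0%nat ->
    (forall j, (j < n)%coq_nat -> exists w, eval f (j :: v) (S w)) ->
    eval (cMu f) v n
with evals : list code -> list nat -> list nat -> Prop :=
| esNil v : evals nil v nil
| esCons g gs v w ws : eval g v w -> evals gs v ws -> evals (g :: gs) v (w :: ws).

Definition computable_seq (p : nat -> nat) : Prop :=
  exists c, forall k, eval c (k :: nil) (p k).

Definition cpair (a b : nat) : nat := Nat.add (Nat.div ((a + b) * (a + b + 1)) 2) b.

Fixpoint code_list (l : list nat) : nat :=
  match l with nil => 0%nat | x :: l' => S (cpair x (code_list l')) end.

Definition prefix (p : nat -> nat) (k : nat) : list nat := List.map p (List.seq 0%nat k).

(* inverse Cantor pairing, enumerating the diagonals *)
Fixpoint cunpair (n : nat) : nat * nat :=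
  match n with
  | 0 => (0%nat, 0%nat)
  | S n' => let (a, b) := cunpair n' in
            match a with S a' => (a', S b) | 0 => (S b, 0%nat) end
  end.

Definition z_of_nat (n : nat) : Z :=
  if Nat.even n then Z.of_nat (Nat.div2 n) else (- Z.of_nat (S (Nat.div2 n)))%Z.

Definition q_of_nat (n : nat) : Q :=
  let (a, b) := cunpair n in Qmake (z_of_nat a) (Pos.of_succ_nat b).

Definition Vec (d : nat) := 'I_d -> R.

Definition dist2 {d} (x y : Vec d) : R :=
  List.fold_right Rplus 0%R (List.map (fun i => ((x i - y i) ^ 2)%R) (enum 'I_d)).

Definition in_ball {d} (c : Vec d) (r : R) (x : Vec d) : Prop :=
  (0 < r)%R /\ (dist2 x c < r ^ 2)%R.

Definition is_open {d} (U : Vec d -> Prop) : Prop :=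
  forall x, U x -> exists r, (0 < r)%R /\ forall y, in_ball x r y -> U y.

Definition image {n m} (f : Vec n -> Vec m) (U : Vec n -> Prop) : Vec m -> Prop :=
  fun y => exists x, U x /\ f x = y.

Definition subset {d} (U V : Vec d -> Prop) : Prop := forall x, U x -> V x.

Definition continuous_on {n m} (X : Vec n -> Prop) (f : Vec n -> Vec m) : Prop :=
  forall x, X x -> forall eps, (0 < eps)%R -> exists delta, (0 < delta)%R /\
    forall y, X y -> (dist2 y x < delta ^ 2)%R -> (dist2 (f y) (f x) < eps ^ 2)%R.

Definition qvec_of_nat (d : nat) (n : nat) : 'I_d -> Q :=
  fun i => q_of_nat (fst (cunpair (Nat.iter (nat_of_ord i) (fun m : nat => snd (cunpair m)) n))).

Definition rvec_of_nat (d : nat) (n : nat) : Vec d := fun i => Q2R (qvec_of_nat d n i).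

Definition cauchy_name (d : nat) (p : nat -> nat) (x : Vec d) : Prop :=
  forall k (i : 'I_d), (Rabs (rvec_of_nat d (p k) i - x i) <= / 2 ^ k)%R.

Definition ball_of_nat (d : nat) (n : nat) : Vec d * R :=
  let (a, b) := cunpair n in (rvec_of_nat d a, Q2R (q_of_nat b)).

Definition theta_name (d : nat) (p : nat -> nat) (U : Vec d -> Prop) : Prop :=
  forall x, U x <-> exists k, in_ball (fst (ball_of_nat d (p k))) (snd (ball_of_nat d (p k))) x.

Definition re_open (d : nat) (X : Vec d -> Prop) : Prop :=
  exists p, computable_seq p /\ theta_name d p X.

(* 5. Type-2 machines, via partial recursive associates: machine c on
      input p produces q with q n = v iff, querying c on
      <n, code(p 0 .. p (k-1))> for k = 0,1,2,..., all answers are 0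
      (= "need more input") until the first answer v+1. *)
Definition tm_computes (c : code) (p q : nat -> nat) : Prop :=
  forall n, exists k,
    eval c (cpair n (code_list (prefix p k)) :: nil) (S (q n)) /\
    forall j, (j < k)%coq_nat -> eval c (cpair n (code_list (prefix p j)) :: nil) 0%nat.

Definition computable_on {n m} (X : Vec n -> Prop) (f : Vec n -> Vec m) : Prop :=
  exists c, forall x, X x -> forall p, cauchy_name n p x ->
    exists q, tm_computes c p q /\ cauchy_name m q (f x).

Definition open_on {n m} (X : Vec n -> Prop) (f : Vec n -> Vec m) : Prop :=
  forall U, is_open U -> subset U X -> is_open (image f U).

Definition eff_open_on {n m} (X : Vec n -> Prop) (f : Vec n -> Vec m) : Prop :=
  open_on X f /\
  exists c, forall U p, is_open U -> subset U X -> theta_name n p U ->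
    exists q, tm_computes c p q /\ theta_name m q (image f U).

Definition component {n m} (i : 'I_m) (f : Vec n -> Vec m) : Vec n -> Vec 1 :=
  fun x => fun _ => f x i.

(* Main.v *)
(* (a) Along an interval, a continuous open real function has no interior
   extremum, so [f x] lies between [f s] and [f t] whenever [s < x < t]. To
   approximate [f x], search for rational balls [e1 < x < e2] inside one ball
   of the name of [X], and for balls enumerated in [f e1] and [f e2] whose
   centers [y1], [y2] are at distance at most [2^-n]; as [y1], [y2] are values
   of [f] on either side of [x], [y1] is within [2^-n] of [f x].
   (b) The projection of a ball is an interval with the same radius, so
   components inherit continuity and effective openness; if they were all
   computable, so would be [f]. *)
Require Import Defs.
From Stdlib Require Import Reals QArith Qreals List.
From mathcomp Require Import ssreflect ssrbool ssrnat eqtype seq fintype.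
From Stdlib Require Import Lra Lia FunctionalExtensionality ClassicalEpsilon.
From mathcomp Require Import ssrfun zify.

(** No modulus of continuity for [f] is available, so an approximation of [f x] has to be certified
    by order alone: being between two nearby values pins [f x] down, whichever of the two is larger.
    Continuity gives soundness through the existence of a maximum, and termination because small
    balls near [x] have images near [f x]. The obstacle is partiality. The machine that comes with
    effective openness is specified only on names of open subsets of [X]; elsewhere, and on prefixes
    longer than the one it answers on, it may diverge, whereas the new machine must return 0 on
    every query before its answer. Hence machines are latched at their first answer and called only
    behind decidable tests that place their input inside [X]. This is one reason to demand a single
    ball of the name of [X] around [e1] and [e2]: containment in one rational ball is decidable. The
    other is convexity, which puts the whole interval between [e1] and [e2] inside [X]. *)

Local Open Scope nat_scope.
(* [seq] and [fintype] shadow these names. *)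
Local Notation prefix := Defs.prefix.
Local Notation subset := Defs.subset.
Local Notation image := Defs.image.

(* [F a] is computed from the numbers [e a], [e] in [E], by one code for all
   [a] in [D]; outside [D] the code may diverge, which is what allows running
   a machine only on inputs where it is known to answer. The type [A] may
   carry noncomputable data, such as an oracle. *)
Definition cf {A} (D : A -> Prop) (E : list (A -> nat)) (F : A -> nat) : Prop :=
  exists c, forall a, D a -> eval c (List.map (fun e => e a) E) (F a).

(** * Closure of codes under composition, recursion and minimization *)

Lemma cf_ext {A} (D D' : A -> Prop) E F' F :
  cf D' E F' -> (forall a, D a -> D' a) -> (forall a, D a -> F' a = F a) ->
  cf D E F.
Proof. by move=> [c Hc] HD HF; exists c => a Da; rewrite -HF //; apply/Hc/HD. Qed.

(** Composition. The map [phi] may rearrange noncomputable data at will; only the numbers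
    [e (phi a)] have to be computed. *)
Lemma cf_subst {A B} (D : A -> Prop) (D' : B -> Prop) (phi : A -> B) E E' F' :
  cf D' E' F' -> (forall a, D a -> D' (phi a)) ->
  List.Forall (fun e => cf D E (fun a => e (phi a))) E' ->
  cf D E (fun a => F' (phi a)).
Proof.
move=> [c Hc] HD HE.
have [gs Hgs] : exists gs, forall a, D a ->
    evals gs (List.map (fun e => e a) E) (List.map (fun e => e (phi a)) E').
  elim: HE => [|e E1 [g Hg] _ [gs Hgs]]; first by exists nil => a _; constructor.
  by exists (g :: gs) => a Da; constructor; [apply: Hg | apply: Hgs].
by exists (cComp c gs) => a Da; apply: (eComp _ _ _ _ _ (Hgs a Da)); apply/Hc/HD.
Qed.

Lemma cf_var {A} (i : nat) (D : A -> Prop) E F :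
  List.nth_error E i = Some F -> cf D E F.
Proof.
move=> HE; exists (cProj i) => a _.
have -> : F a = List.nth i (List.map (fun e => e a) E) 0; last exact: eProj.
by symmetry; apply: nth_error_nth; rewrite nth_error_map HE.
Qed.

Lemma cf_vars {A B} (D : A -> Prop) (phi : A -> B) pre E :
  List.Forall (fun e => cf D (pre ++ List.map (fun e a => e (phi a)) E)
                          (fun a => e (phi a))) E.
Proof.
apply/Forall_forall => e He; have [i Hi] := In_nth_error _ _ He.
apply: (cf_var (List.length pre + i)).
rewrite nth_error_app2; last by lia.
have -> : (List.length pre + i - List.length pre)%coq_nat = i by lia.
by rewrite nth_error_map Hi.
Qed.

Lemma cf_lift {A B} (D : A -> Prop) (D' : B -> Prop) (phi : A -> B) pre E F :
  cf D' E F -> (forall a, D a -> D' (phi a)) ->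
  cf D (pre ++ List.map (fun e a => e (phi a)) E) (fun a => F (phi a)).
Proof. by move=> HF HD; apply: (cf_subst _ _ _ _ _ _ HF HD); apply: cf_vars. Qed.

(** The domain of the step records that the counter is below [N] and that the accumulator holds the
    true value, so a partial step has to converge only on states that the recursion reaches. *)
Lemma cf_rec {A} (D : A -> Prop) E F (G : A -> nat -> nat -> nat) N :
  cf D E F -> cf D E N ->
  cf (fun z : A * nat * nat => D z.1.1 /\ (z.1.2 < N z.1.1) /\
        z.2 = nat_rect _ (F z.1.1) (G z.1.1) z.1.2)
     ((fun z => z.1.2) :: (fun z => z.2) :: List.map (fun e z => e z.1.1) E)
     (fun z => G z.1.1 z.1.2 z.2) ->
  cf D E (fun a => nat_rect _ (F a) (G a) (N a)).
Proof.
move=> [f Hf] [n Hn] [g Hg].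
have [ps Hps] : exists ps, forall v : A, 
    evals ps (List.map (fun e => e v) E) (List.map (fun e => e v) E).
  have : List.Forall (fun e => cf (fun _ : A => True) E e) E.
    have := cf_vars (fun _ : A => True) id nil E.
    have -> : [::] ++ List.map (fun e a => e (id a)) E = E.
      by rewrite /= -[RHS]List.map_id.
    by [].
  (* Only the list of outputs shrinks; the input vector remains the full [E]. *)
  elim: {2 4}E => [_|e E1 IH H]; first by exists nil => a; constructor.
  inversion H as [|? ? [c Hc] H1]; subst; case: (IH H1) => ps Hps.
  by exists (c :: ps) => a; constructor; [apply: Hc|apply: Hps].
exists (cComp (cRec f g) (n :: ps)) => a Da.
apply: (eComp _ _ _ (N a :: List.map (fun e => e a) E)).
  by constructor; [apply: Hn|apply: Hps].
have H : forall k, k <= N a -> eval (cRec f g) (k :: List.map (fun e => e a) E)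
    (nat_rect _ (F a) (G a) k).
  elim=> [|k IH] Hk; first by apply: eRec0; apply: Hf.
  apply: eRecS; first by apply: IH; lia.
  have := Hg (a, k, nat_rect _ (F a) (G a) k); rewrite /= List.map_map; apply.
  by split; last split.
exact: H.
Qed.

(** The search never looks past [M], so nothing is asked of [F] beyond it. *)
Lemma cf_mu {A} (D : A -> Prop) E (F : A -> nat -> nat) M :
  cf (fun z : A * nat => D z.1 /\ z.2 <= M z.1)
     ((fun z => z.2) :: List.map (fun e z => e z.1) E) (fun z => F z.1 z.2) ->
  (forall a, D a -> F a (M a) = 0) ->
  (forall a n, D a -> n < M a -> F a n <> 0) ->
  cf D E M.
Proof.
move=> [f Hf] H0 H1; exists (cMu f) => a Da; apply: eMu.
  have := Hf (a, M a); rewrite /= List.map_map H0 //; apply; split=> //.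
move=> j Hj; have := Hf (a, j); rewrite /= List.map_map.
case: (F a j) (H1 a j Da (introT ltP Hj)) => // w _ H; exists w; apply: H; split=> //=; lia.
Qed.

(** * Elementary arithmetic functions *)

Definition comp1 (h : nat -> nat) := cf (fun _ : nat => True) [:: id] h.
Definition comp2 (h : nat -> nat -> nat) :=
  cf (fun _ : nat * nat => True) [:: fst; snd] (fun z => h z.1 z.2).

Lemma cf1 {A} h (D : A -> Prop) E F : comp1 h -> cf D E F -> cf D E (fun a => h (F a)).
Proof. by move=> Hh HF; apply: (cf_subst _ _ F _ _ _ Hh) => //; repeat constructor. Qed.

Lemma cf2 {A} h (D : A -> Prop) E F G :
  comp2 h -> cf D E F -> cf D E G -> cf D E (fun a => h (F a) (G a)).
Proof.
move=> Hh HF HG; apply: (cf_subst _ _ (fun a => (F a, G a)) _ _ _ Hh) => //.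
by repeat constructor.
Qed.

Lemma comp1S : comp1 S.
Proof. by exists cSucc => a _; apply: (eSucc [:: a]). Qed.

Lemma cf_const {A} (D : A -> Prop) E n : cf D E (fun _ => n).
Proof.
elim: n => [|n IH]; first by exists cZero => a _; apply: eZero.
exact: (cf1 _ _ _ _ comp1S IH).
Qed.

Lemma comp2_add : comp2 addn.
Proof.
apply: (cf_ext _ (fun _ => True) _ (fun z => nat_rect _ z.1 (fun _ y => S y) z.2)) => //.
  apply: (cf_rec _ _ _ (fun _ _ y => S y)); [exact: (cf_var 0)|exact: (cf_var 1)|].
  by apply: (cf1 S); [exact: comp1S|exact: (cf_var 1)].
by move=> [a b] _ /=; elim: b => [|b IH] /=; lia.
Qed.

Lemma comp2_mul : comp2 muln.
Proof.
apply: (cf_ext _ (fun _ => True) _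
  (fun z => nat_rect _ 0 (fun _ y => y + z.1) z.2)) => //.
  apply: (cf_rec _ _ _ (fun z _ y => y + z.1)); [exact: cf_const|exact: (cf_var 1)|].
  by apply: (cf2 addn); [exact: comp2_add|exact: (cf_var 1)|exact: (cf_var 2)].
by move=> [a b] _ /=; elim: b => [|b IH] /=; lia.
Qed.

Lemma comp1_pred : comp1 predn.
Proof.
apply: (cf_ext _ (fun _ => True) _ (fun z => nat_rect _ 0 (fun n _ => n) z)) => //.
  apply: (cf_rec _ _ _ (fun _ n _ => n)); [exact: cf_const|exact: (cf_var 0)|].
  exact: (cf_var 0).
by case.
Qed.

Lemma comp2_sub : comp2 subn.
Proof.
apply: (cf_ext _ (fun _ => True) _
  (fun z => nat_rect _ z.1 (fun _ y => predn y) z.2)) => //.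
  apply: (cf_rec _ _ _ (fun _ _ y => predn y)); [exact: (cf_var 0)|exact: (cf_var 1)|].
  by apply: (cf1 predn); [exact: comp1_pred|exact: (cf_var 1)].
by move=> [a b] _ /=; elim: b => [|b IH] /=; lia.
Qed.

Lemma comp2_leq : comp2 (fun a b => a <= b).
Proof.
apply: (cf_ext _ (fun _ => True) _ (fun z => 1 - (z.1 - z.2))) => //.
  apply: (cf2 subn); [exact: comp2_sub|exact: cf_const|exact: comp2_sub].
by move=> [a b] _ /=; case: (leqP a b) => /=; lia.
Qed.

(* Code composition is strict, so a partial [G] can only be protected by the
   recursor, which does not run its step when the counter is 0. *)
Lemma cf_guard {A} (D : A -> Prop) E B G :
  cf D E B -> cf (fun a => D a /\ B a <> 0) E G ->
  cf D E (fun a => if B a is 0 then 0 else G a).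
Proof.
move=> HB HG.
apply: (cf_ext _ D _ (fun a => nat_rect _ 0 (fun _ _ => G a) (1 <= B a : nat))) => //.
  apply: (cf_rec _ _ _ (fun a _ _ => G a)); first exact: cf_const.
    by apply: (cf2 (fun a b => nat_of_bool (a <= b))); [exact: comp2_leq|exact: cf_const|].
  apply: (cf_lift _ _ (fun z : A * nat * nat => z.1.1) [:: _; _] _ _ HG).
  move=> [[a n] y] /= [Da [Hn _]]; split=> //.
  by move=> B0; rewrite B0 in Hn; lia.
by move=> a _; case: (B a).
Qed.

(** * Cantor pairing *)

(** Triangular numbers, by a recursion that fits [cf_rec] and replaces the division in [cpair]. *)
Definition tri n := nat_rect _ 0 (fun n y => y + S n) n.

Arguments tri : simpl never.

Lemma triS n : tri (S n) = tri n + S n.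
Proof. by []. Qed.

Lemma cpairE a b : cpair a b = tri (a + b) + b.
Proof.
rewrite /cpair; have -> : Nat.div ((a + b) * (a + b + 1)) 2 = tri (a + b); last by [].
have H : (a + b) * (a + b + 1) = 2 * tri (a + b).
  elim: (a + b) => [|n IH] //; rewrite !triS; lia.
by rewrite H mulnC; apply: Nat.div_mul.
Qed.

Lemma tri_le m n : m <= n -> tri m <= tri n.
Proof.
move=> Hmn; have -> : n = m + (n - m) by lia.
elim: (n - m) => [|k IH]; first by rewrite addn0.
by rewrite addnS !triS; lia.
Qed.

Lemma cunpairE n : cpair (cunpair n).1 (cunpair n).2 = n.
Proof.
elim: n => [|n] //=; case: (cunpair n) => [[|a] b] /=; rewrite !cpairE => <-.
- by rewrite add0n !addn0 triS; lia.
- have -> : a + S b = S a + b by lia.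
  lia.
Qed.

(** The codes of pairs with sum [s] lie between [tri s] and [tri s + s], hence below [tri (S s)], so
    the code determines the sum. *)
Lemma cpair_inj a b a' b' : cpair a b = cpair a' b' -> (a, b) = (a', b').
Proof.
rewrite !cpairE => H.
have key : forall x y x' y', tri (x + y) + y = tri (x' + y') + y' -> x + y <= x' + y'.
  move=> x y x' y' E; rewrite leqNgt; apply/negP => L.
  have := tri_le _ _ L; rewrite !triS; lia.
have E : a + b = a' + b'.
  by apply/eqP; rewrite eqn_leq (key _ _ _ _ H) (key _ _ _ _ (esym H)).
rewrite E in H; f_equal; lia.
Qed.

Lemma cunpair_cpair a b : cunpair (cpair a b) = (a, b).
Proof.
have := cunpairE (cpair a b) => /cpair_inj <-.
by case: (cunpair _).
Qed.

Lemma comp1_tri : comp1 tri.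
Proof.
apply: (cf_rec _ _ (fun _ => 0) (fun _ n y => y + S n)); [exact: cf_const|exact: (cf_var 0)|].
apply: (cf2 addn); [exact: comp2_add|exact: (cf_var 1)|].
apply: (cf1 S); [exact: comp1S|exact: (cf_var 0)].
Qed.

Lemma comp2_cpair : comp2 cpair.
Proof.
apply: (cf_ext _ (fun _ => True) _ (fun z => tri (z.1 + z.2) + z.2)) => //.
  apply: (cf2 addn); [exact: comp2_add| |exact: (cf_var 1)].
  apply: (cf1 tri); [exact: comp1_tri|exact: comp2_add].
by move=> [a b] _; rewrite cpairE.
Qed.

(** The sum is the least [s] with [n < tri (S s)], which is when the truncated difference
    vanishes. *)
Lemma comp1_cunpair_sum : comp1 (fun n => (cunpair n).1 + (cunpair n).2).
Proof.
apply: (cf_mu _ _ (fun n s => S n - tri (S s))).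
- apply: (cf2 subn); first exact: comp2_sub.
    by apply: (cf1 S); [exact: comp1S|exact: (cf_var 1)].
  apply: (cf1 tri); [exact: comp1_tri|apply: (cf1 S); [exact: comp1S|exact: (cf_var 0)]].
- move=> n _; have := cunpairE n; case: (cunpair n) => a b /=.
  by rewrite cpairE => <-; rewrite !triS; lia.
- move=> n s _; have := cunpairE n; case: (cunpair n) => a b /=.
  by rewrite cpairE => <- /tri_le; lia.
Qed.

Lemma comp1_snd : comp1 (fun n => (cunpair n).2).
Proof.
apply: (cf_ext _ (fun _ => True) _
  (fun n => n - tri ((cunpair n).1 + (cunpair n).2))) => //.
  apply: (cf2 subn); [exact: comp2_sub|exact: (cf_var 0)|].
  by apply: (cf1 tri); [exact: comp1_tri|exact: comp1_cunpair_sum].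
by move=> n _; have := cunpairE n; case: (cunpair n) => a b /=; rewrite cpairE; lia.
Qed.

Lemma comp1_fst : comp1 (fun n => (cunpair n).1).
Proof.
apply: (cf_ext _ (fun _ => True) _
  (fun n => (cunpair n).1 + (cunpair n).2 - (cunpair n).2)) => //.
  by apply: (cf2 subn); [exact: comp2_sub|exact: comp1_cunpair_sum|exact: comp1_snd].
by move=> n _; lia.
Qed.

(** * Coded prefixes and oracle queries *)

(** List codes grow at the head, so the recursion reads the sequence backwards from its entry at
    [K a - 1]. *)
Lemma cf_code_prefix {A} (D : A -> Prop) E (P : A -> nat -> nat) K :
  cf D E K ->
  cf (fun z : A * nat => D z.1 /\ z.2 < K z.1)
     ((fun z => z.2) :: List.map (fun e z => e z.1) E) (fun z => P z.1 z.2) ->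
  cf D E (fun a => code_list (prefix (P a) (K a))).
Proof.
move=> HK HP.
apply: (cf_ext _ D _ (fun a => nat_rect _ 0
   (fun t y => S (cpair (P a (K a - S t)) y)) (K a))) => //.
  apply: (cf_rec _ _ _ (fun a t y => S (cpair (P a (K a - S t)) y))) => //.
    exact: cf_const.
  apply: (cf1 S); first exact: comp1S.
  apply: (cf2 cpair); [exact: comp2_cpair| |exact: (cf_var 1)].
  apply: (cf_subst _ _ (fun z => (z.1.1, K z.1.1 - S z.1.2)) _ _ _ HP).
    move=> [[a t] y] /= [Da [Ht _]]; split=> //; lia.
  constructor.
    apply: (cf2 subn); [exact: comp2_sub| |apply: (cf1 S); [exact: comp1S|exact: (cf_var 0)]].
    by apply: (cf_lift _ _ (fun z : A * nat * nat => z.1.1) [:: _; _] _ _ HK) => z [].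
  apply/List.Forall_map.
  by apply: (cf_vars _ (fun z : A * nat * nat => z.1.1) [:: _; _]).
move=> a _; rewrite /prefix; have H : forall t, t <= K a -> nat_rect (fun _ => nat) 0
   (fun t y => S (cpair (P a (K a - S t)) y)) t =
   code_list (List.map (P a) (List.seq (K a - t) t)).
  elim=> [|t IH] Ht //=; rewrite IH; last by lia.
  by have -> : S (K a - S t) = K a - t by lia.
by rewrite H // subnn.
Qed.

(** For [z = (n, p, k)]: the argument passed to a machine asked for output [n] after [k] entries of
    the oracle [p]. With [[:: query]] as variables, a [cf] statement describes a machine that sees
    [p] only through this prefix. *)
Definition query (z : nat * (nat -> nat) * nat) : nat :=
  cpair z.1.1 (code_list (prefix z.1.2 z.2)).

Lemma cf_query_index {D} : cf D [:: query] (fun z => z.1.1).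
Proof.
apply: (cf_ext _ D _ (fun z => (cunpair (query z)).1)) => //.
  apply: (cf1 (fun n => (cunpair n).1)); [exact: comp1_fst|exact: (cf_var 0)].
by move=> z _; rewrite cunpair_cpair.
Qed.

Definition tails l i := nat_rect (fun _ => nat) l (fun _ y => (cunpair (predn y)).2) i.

Lemma comp2_tails : comp2 tails.
Proof.
apply: (cf_rec _ _ (fun z => z.1) (fun _ _ y => (cunpair (predn y)).2));
  [exact: (cf_var 0)|exact: (cf_var 1)|].
apply: (cf1 (fun n => (cunpair n).2)); first exact: comp1_snd.
by apply: (cf1 predn); [exact: comp1_pred|exact: (cf_var 1)].
Qed.

Lemma tailsE p k i : i <= k ->
  tails (code_list (prefix p k)) i = code_list (List.map p (List.seq i (k - i))).
Proof.
elim: i => [|i IH] Hi; first by rewrite subn0.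
rewrite /= IH; last by lia.
have -> : k - i = S (k - S i) by lia.
by rewrite /= cunpair_cpair.
Qed.

Lemma cf_query_list {D} : cf D [:: query] (fun z => code_list (prefix z.1.2 z.2)).
Proof.
apply: (cf_ext _ D _ (fun z => (cunpair (query z)).2)) => //.
  apply: (cf1 (fun n => (cunpair n).2)); [exact: comp1_snd|exact: (cf_var 0)].
by move=> z _; rewrite cunpair_cpair.
Qed.

(** The length is the least number of entries whose removal leaves 0, the code of the empty list. *)
Lemma cf_query_length {D} : cf D [:: query] (fun z => z.2).
Proof.
apply: (cf_mu _ _ (fun z i => tails (code_list (prefix z.1.2 z.2)) i)).
- apply: (cf2 tails); [exact: comp2_tails| |exact: (cf_var 0)].
  by apply: (cf_lift _ D (fun z => z.1) [:: _] _ _ cf_query_list) => z [].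
- by move=> z _; rewrite tailsE // subnn.
- move=> z i _ Hi; rewrite tailsE; last by lia.
  by have -> : z.2 - i = S (z.2 - S i) by lia.
Qed.

Lemma cf_query_nth {A} (D : A -> Prop) E F (I : A -> nat) :
  cf D E (fun a => query (F a)) -> cf D E I -> (forall a, D a -> I a < (F a).2) ->
  cf D E (fun a => (F a).1.2 (I a)).
Proof.
move=> HF HI Hlt.
apply: (cf_ext _ D _ (fun a => (cunpair (predn (tails
    (code_list (prefix (F a).1.2 (F a).2)) (I a)))).1)) => //.
  apply: (cf1 (fun n => (cunpair n).1)); first exact: comp1_fst.
  apply: (cf1 predn); first exact: comp1_pred.
  apply: (cf2 tails) => //; first exact: comp2_tails.
  apply: (cf_subst _ (fun _ => True) F _ _ _ cf_query_list) => //; by repeat constructor.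
move=> a /Hlt H; rewrite tailsE; last by lia.
have -> : (F a).2 - I a = S ((F a).2 - S (I a)) by lia.
by rewrite /= cunpair_cpair.
Qed.

(** * Rational arithmetic *)

(** Codes handle naturals only, so a rational is a difference of naturals over a positive
    denominator, never reduced. [F] is real-valued to let field reasoning apply. *)
Definition cfR {A} (D : A -> Prop) (E : list (A -> nat)) (F : A -> R) : Prop :=
  exists P N Q, [/\ cf D E P, cf D E N, cf D E Q &
    forall a, D a -> (0 < INR (Q a) /\ F a = (INR (P a) - INR (N a)) / INR (Q a))%R].

Lemma INR_addn a b : INR (a + b) = (INR a + INR b)%R.
Proof. exact: plus_INR. Qed.

Lemma INR_muln a b : INR (a * b) = (INR a * INR b)%R.
Proof. exact: mult_INR. Qed.

Lemma cfR_add {A} (D : A -> Prop) E F G :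
  cfR D E F -> cfR D E G -> cfR D E (fun a => F a + G a)%R.
Proof.
move=> [P [N [Q [HP HN HQ H]]]] [P' [N' [Q' [HP' HN' HQ' H']]]].
exists (fun a => P a * Q' a + P' a * Q a), (fun a => N a * Q' a + N' a * Q a),
  (fun a => Q a * Q' a).
split; try by repeat first [assumption | apply: (cf2 _ _ _ _ _ comp2_add)
                           | apply: (cf2 _ _ _ _ _ comp2_mul)].
move=> a Da; have [q ->] := H a Da; have [q' ->] := H' a Da.
rewrite !INR_addn !INR_muln; split; first exact: Rmult_lt_0_compat.
by field; lra.
Qed.

Lemma cfR_opp {A} (D : A -> Prop) E F : cfR D E F -> cfR D E (fun a => - F a)%R.
Proof.
move=> [P [N [Q [HP HN HQ H]]]]; exists N, P, Q; split=> // a Da.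
by have [q ->] := H a Da; split=> //; field; lra.
Qed.

Lemma cfR_sub {A} (D : A -> Prop) E F G :
  cfR D E F -> cfR D E G -> cfR D E (fun a => F a - G a)%R.
Proof. by move=> HF /cfR_opp; apply: cfR_add. Qed.

Lemma cfR_0 {A} (D : A -> Prop) E : cfR D E (fun _ => 0%R).
Proof.
exists (fun _ => 0), (fun _ => 0), (fun _ => 1); split; try exact: cf_const.
by move=> a _ /=; split; lra.
Qed.

Lemma cfR_pow {A} (D : A -> Prop) E F : cf D E F -> cfR D E (fun a => / 2 ^ F a)%R.
Proof.
move=> HF.
exists (fun _ => 1), (fun _ => 0), (fun a => nat_rect (fun _ => nat) 1 (fun _ y => y + y) (F a)).
split; try exact: cf_const.
  apply: (cf_rec _ _ _ (fun _ _ y => y + y)) => //; first exact: cf_const.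
  by apply: (cf2 _ _ _ _ _ comp2_add); exact: (cf_var 1).
move=> a _.
have -> : INR (nat_rect (fun _ => nat) 1 (fun _ y => y + y) (F a)) = (2 ^ F a)%R.
  elim: (F a) => [|n IH]; first by [].
  have -> : nat_rect (fun _ => nat) 1 (fun _ y => y + y) (S n) =
     nat_rect (fun _ => nat) 1 (fun _ y => y + y) n +
     nat_rect (fun _ => nat) 1 (fun _ y => y + y) n by [].
  by rewrite INR_addn IH /=; ring.
have := pow_lt 2 (F a) ltac:(lra) => H; split=> //=; field; lra.
Qed.

(** Cross-multiplying and moving the negative parts to the other side leaves a comparison of
    naturals. *)
Lemma cf_le {A} (D : A -> Prop) E F G :
  cfR D E F -> cfR D E G ->
  cf D E (fun a => if Rle_dec (F a) (G a) then 1 else 0).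
Proof.
move=> [P [N [Q [HP HN HQ H]]]] [P' [N' [Q' [HP' HN' HQ' H']]]].
apply: (cf_ext _ D _ (fun a => nat_of_bool (P a * Q' a + N' a * Q a
   <= P' a * Q a + N a * Q' a))) => //.
  apply: (cf2 _ _ _ _ _ comp2_leq);
  by repeat first [assumption | apply: (cf2 _ _ _ _ _ comp2_add)
                           | apply: (cf2 _ _ _ _ _ comp2_mul)].
move=> a Da; have [q ->] := H a Da; have [q' ->] := H' a Da.
set X := (_ + _)%N; set Y := (_ + _)%N.
have E1 : ((INR (P' a) - INR (N' a)) / INR (Q' a) - (INR (P a) - INR (N a)) / INR (Q a)
   = (INR Y - INR X) * (/ INR (Q a) * / INR (Q' a)))%R.
  by rewrite /X /Y !INR_addn !INR_muln; field; lra.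
have p : (0 < / INR (Q a) * / INR (Q' a))%R.
  by apply: Rmult_lt_0_compat; apply: Rinv_0_lt_compat.
case: Rle_dec => L.
  suff -> : X <= Y by [].
  apply/leP; apply: INR_le.
  have [//|L'] := Rle_lt_dec (INR X) (INR Y).
  have := Rmult_lt_0_compat _ _ (Rlt_Rminus _ _ L') p; nra.
case: leqP => // /leP /le_INR L'; exfalso; apply: L.
have := Rmult_le_pos _ _ (Rge_le _ _ (Rge_minus _ _ (Rle_ge _ _ L'))) (Rlt_le _ _ p); lra.
Qed.

Lemma cf_lt {A} (D : A -> Prop) E F G :
  cfR D E F -> cfR D E G ->
  cf D E (fun a => if Rlt_dec (F a) (G a) then 1 else 0).
Proof.
move=> HF HG.
apply: (cf_ext _ D _ (fun a => 1 - (if Rle_dec (G a) (F a) then 1 else 0))) => //.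
  by apply: (cf2 _ _ _ _ _ comp2_sub); [exact: cf_const|exact: cf_le].
move=> a _; case: Rle_dec => H1; case: Rlt_dec => H2 //; exfalso; lra.
Qed.

Lemma comp1_odd : comp1 odd.
Proof.
apply: (cf_ext _ (fun _ => True) _ (fun n => nat_rect (fun _ => nat) 0 (fun _ y => 1 - y) n)) => //.
  apply: (cf_rec _ _ (fun _ => 0) (fun _ _ y => 1 - y)); [exact: cf_const|exact: (cf_var 0)|].
  by apply: (cf2 _ _ _ _ _ comp2_sub); [exact: cf_const|exact: (cf_var 1)].
by move=> n _; elim: n => [|n IH] //=; rewrite IH; case: (odd n).
Qed.

Lemma comp1_half : comp1 half.
Proof.
apply: (cf_ext _ (fun _ => True) _ 
  (fun n => nat_rect (fun _ => nat) 0 (fun n y => y + odd n) n)) => //.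
  apply: (cf_rec _ _ (fun _ => 0) (fun _ n y => y + odd n)); [exact: cf_const|exact: (cf_var 0)|].
  apply: (cf2 _ _ _ _ _ comp2_add); first exact: (cf_var 1).
  by apply: (cf1 _ _ _ _ comp1_odd); exact: (cf_var 0).
by move=> n _; elim: n => [|n IH] //=; rewrite IH uphalf_half; lia.
Qed.

Lemma div2_half n : Nat.div2 n = half n.
Proof.
have [H1 H2] : Nat.div2 n = half n /\ Nat.div2 (S n) = half (S n); last by [].
elim: n => [|n [IH1 IH2]] //; split=> //; rewrite /= in IH1 IH2 *; by rewrite IH1.
Qed.

Lemma IZR_z_of_nat n :
  IZR (z_of_nat n) = (INR ((1 - odd n) * half n) - INR (odd n * S (half n)))%R.
Proof.
have E : Nat.even n = ~~ odd n.
  have [H1 H2] : Nat.even n = ~~ odd n /\ Nat.even (S n) = ~~ odd (S n); last by [].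
  elim: n => [|n [IH1 IH2]] //; split=> //; rewrite /= in IH1 *; by rewrite IH1 !negbK.
rewrite /z_of_nat E div2_half; case: (odd n).
  rewrite opp_IZR -INR_IZR_INZ mul1n mul0n [INR 0]/=; lra.
rewrite -INR_IZR_INZ mul1n mul0n [INR 0]/=; lra.
Qed.

Definition rval n : R := Q2R (q_of_nat n).

Lemma rvalE n :
  rval n = (IZR (z_of_nat (cunpair n).1) / INR (S (cunpair n).2))%R.
Proof.
rewrite /rval /q_of_nat; case: (cunpair n) => a b; rewrite /Q2R.
by rewrite [Qnum _]/= [Qden _]/= [(a, b).1]/= INR_IZR_INZ Znat.Zpos_P_of_succ_nat Znat.Nat2Z.inj_succ.
Qed.

Lemma cfR_rval {A} (D : A -> Prop) E F : cf D E F -> cfR D E (fun a => rval (F a)).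
Proof.
move=> HF.
have H1 := cf1 _ _ _ _ comp1_fst HF; have H2 := cf1 _ _ _ _ comp1_snd HF.
have Ho := cf1 _ _ _ _ comp1_odd H1; have Hh := cf1 _ _ _ _ comp1_half H1.
exists (fun a => (1 - odd (cunpair (F a)).1) * half (cunpair (F a)).1),
  (fun a => odd (cunpair (F a)).1 * S (half (cunpair (F a)).1)),
  (fun a => S (cunpair (F a)).2).
split.
- apply: (cf2 _ _ _ _ _ comp2_mul) => //.
  by apply: (cf2 _ _ _ _ _ comp2_sub) => //; exact: cf_const.
- apply: (cf2 _ _ _ _ _ comp2_mul) => //.
  exact: (cf1 _ _ _ _ comp1S).
- exact: (cf1 _ _ _ _ comp1S).
move=> a _; split; first exact/lt_0_INR/Nat.lt_0_succ.
by rewrite rvalE IZR_z_of_nat.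
Qed.

Lemma z_of_nat_surj z : exists n, z_of_nat n = z.
Proof.
have [Hz|Hz] := ZArith_dec.Z_le_gt_dec 0 z.
  exists ((Z.to_nat z).*2).
  rewrite /z_of_nat -mul2n Nat.even_mul /= Nat.div2_double; lia.
exists ((Z.to_nat (- z - 1)).*2.+1).
rewrite /z_of_nat -mul2n Nat.even_succ -Nat.negb_even Nat.even_mul.
set m := Z.to_nat _; rewrite [~~ _]/= Nat.div2_succ_double /m; lia.
Qed.

Lemma rval_dense (u v : R) : (u < v)%R -> exists n, (u < rval n < v)%R.
Proof.
move=> Huv; have [[|N] [HN /ltP // _]] := archimed_cor1 (v - u) ltac:(lra).
set M := INR (S N) in HN; have HM : (0 < M)%R by apply/lt_0_INR/Nat.lt_0_succ.
have [Z1 Z2] := archimed (u * M).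
(* [up (u * M)] exceeds [u * M] by at most 1, and [1 < (v - u) * M]. *)
have [a Ha] := z_of_nat_surj (up (u * M)).
exists (cpair a N); rewrite rvalE cunpair_cpair /= Ha -/M.
have HiM : (M * / M = 1)%R by apply: Rinv_r; lra.
split; apply: (Rmult_lt_reg_r M) => //; rewrite /Rdiv ?Rmult_assoc ?(Rmult_comm (/ M)) ?HiM.
  by lra.
have : (/ M * M < (v - u) * M)%R by apply: Rmult_lt_compat_r.
rewrite (Rmult_comm (/ M)) HiM; lra.
Qed.

(** * Type-2 machines *)

(* The latched machine keeps returning its first nonzero answer, whatever [c]
   does (possibly diverge) on longer prefixes. *)
Lemma cf_latch c :
  cf (fun z : nat * (nat -> nat) * nat * (nat -> nat) * nat =>
        eval c (query (z.1.1.1, z.2) :: nil) (S (z.1.2 z.1.1.1.1)) /\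
        forall j, j < z.2 -> eval c (query (z.1.1.1, j) :: nil) 0)
     [:: fun z => query z.1.1]
     (fun z => if z.2 <= z.1.1.2 then S (z.1.2 z.1.1.1.1) else 0).
Proof.
set D := (fun _ => _ /\ _).
(* Stage [j] consults [c] only while the accumulator [y] is 0, so [c] never runs on a prefix longer
   than [z.2], where its first answer occurs. *)
pose step (z : nat * (nat -> nat) * nat * (nat -> nat) * nat) (j y : nat) : nat :=
  y + (if 1 - y is 0 then 0 else if j == z.2 then S (z.1.2 z.1.1.1.1) else 0).
pose y z t := nat_rect (fun _ => nat) 0 (step z) t.
have yE z t : y z t = if z.2 < t then S (z.1.2 z.1.1.1.1) else 0.
  elim: t => [|t IH] //; rewrite [LHS]/(step z t (y z t)) IH /step ltnS.
  by case: (ltngtP t z.2) => L //=; rewrite addn0.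
(* The prefix lengths from 0 to [z.1.1.2] inclusive take [S z.1.1.2] rounds. *)
apply: (cf_ext _ D _ (fun z => y z (S z.1.1.2))) => [|//|z _]; last by rewrite yE ltnS.
apply: (cf_rec _ _ _ step); first exact: cf_const.
  apply: (cf1 _ _ _ _ comp1S).
  apply: (cf_subst _ (fun _ => True) (fun z => z.1.1) _ _ _ cf_query_length) => //.
  by constructor=> //; exact: (cf_var 0).
apply: (cf2 _ _ _ _ _ comp2_add); first exact: (cf_var 1).
apply: cf_guard.
  by apply: (cf2 _ _ _ _ _ comp2_sub); [exact: cf_const|exact: (cf_var 1)].
pose E := [:: fun z : nat * (nat -> nat) * nat * (nat -> nat) * nat => query z.1.1].
suff H : cf (fun z => (D z.1.1 /\ z.1.2 < S z.1.1.1.1.2 /\ z.2 = y z.1.1 z.1.2) /\ 1 - z.2 <> 0)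
     ((fun z => z.1.2) :: (fun z => z.2) :: List.map (fun e z => e z.1.1) E)
     (fun z => query (z.1.1.1.1.1, z.1.2)).
  have [g Hg] := H.
  exists (cComp c [:: g]) => z Dz; have [[D1 [D2 D3]] D4] := Dz.
  apply: eComp; first by constructor; [apply: Hg|constructor].
  have {}D3 : z.2 = y z.1.1 z.1.2 := D3.
  rewrite D3 yE in D4; case: ltnP D4 => // L D4.
  case: eqP => [->|N]; first exact: (proj1 D1).
  by apply: (proj2 D1); lia.
apply: (cf2 _ _ _ _ _ comp2_cpair).
  apply: (cf_subst _ (fun _ => True) (fun z => z.1.1.1.1) _ _ _ cf_query_index) => //.
  by constructor=> //; exact: (cf_var 2).
apply: (cf_code_prefix _ _ (fun z => z.1.1.1.1.1.2) (fun z => z.1.2)); first exact: (cf_var 0).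
apply: (cf_query_nth _ _ (fun z => z.1.1.1.1.1)).
- exact: (cf_var 3).
- exact: (cf_var 0).
- by move=> [[[z ?] ?] i] /= [[[_ [? _]] _] ?]; lia.
Qed.

(** [K p q n] is the prefix length of the first answer. It is chosen classically and does not depend
    on the prefix at hand, so the latched answer changes from 0 exactly once as the prefix grows. *)
Lemma cf_latch_fun c :
  exists K : (nat -> nat) -> (nat -> nat) -> nat -> nat,
  cf (fun z : nat * (nat -> nat) * nat * (nat -> nat) => tm_computes c z.1.1.2 z.2)
     [:: fun z => query z.1]
     (fun z => if K z.1.1.2 z.2 z.1.1.1 <= z.1.2 then S (z.2 z.1.1.1) else 0).
Proof.
pose good p q n k := eval c (query (n, p, k) :: nil) (S (q n)) /\
   forall j, j < k -> eval c (query (n, p, j) :: nil) 0.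
exists (fun p q n => epsilon (inhabits 0) (good p q n)).
apply: (cf_subst _ _ (fun z => (z, epsilon (inhabits 0) (good z.1.1.2 z.2 z.1.1.1))) _ _ _ (cf_latch c)).
  move=> [[[n p] k] q] /= H; apply: (epsilon_spec (inhabits 0) (good p q n)).
  have [k0 [H1 H2]] := H n; exists k0; split=> // j /ltP; exact: H2.
by constructor=> //; exact: (cf_var 0).
Qed.

(** The output is the first nonzero answer minus 1. A property shared by all nonzero answers thus
    passes to the output, without identifying which answer came first. *)
Lemma tm_of_answers c p (a : nat -> nat -> nat) :
  (forall n k, eval c (query (n, p, k) :: nil) (a n k)) ->
  (forall n, exists k, a n k <> 0) ->
  exists q, tm_computes c p q /\ forall n, exists k, a n k = S (q n).
Proof.
move=> Ha Hex.
have Hex' n : exists k, a n k != 0 by have [k /eqP Hk] := Hex n; exists k.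
have Hs n : a n (ex_minn (Hex' n)) = S (predn (a n (ex_minn (Hex' n)))).
  by case: ex_minnP => k; case: (a n k).
exists (fun n => predn (a n (ex_minn (Hex' n)))); split=> n; exists (ex_minn (Hex' n)) => //.
split; first by rewrite -Hs; apply: (Ha n).
move=> j /ltP Hj; have := Ha n j; case: (a n j =P 0) => [->//|/eqP Hn].
by move: Hj; case: ex_minnP => k _ /(_ j Hn); lia.
Qed.

(** The two machines may answer at different prefix lengths. Latching keeps the earlier answer
    available until the later one arrives. *)
Lemma tm_pair c1 c2 h : comp2 h -> exists c, forall p q1 q2,
  tm_computes c1 p q1 -> tm_computes c2 p q2 ->
  tm_computes c p (fun n => h (q1 n) (q2 n)).
Proof.
move=> Hh.
have [K1 H1] := cf_latch_fun c1; have [K2 H2] := cf_latch_fun c2.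
pose l1 z := if K1 z.1.1.2 z.2 z.1.1.1 <= z.1.2 then S (z.2 z.1.1.1) else 0.
pose l2 z := if K2 z.1.1.2 z.2 z.1.1.1 <= z.1.2 then S (z.2 z.1.1.1) else 0.
pose D (z : nat * (nat -> nat) * nat * (nat -> nat) * (nat -> nat)) :=
  tm_computes c1 z.1.1.1.2 z.1.2 /\ tm_computes c2 z.1.1.1.2 z.2.
have H : cf D [:: fun z => query z.1.1] (fun z =>
  if l1 z.1 * l2 (z.1.1, z.2) is 0 then 0
  else S (h (predn (l1 z.1)) (predn (l2 (z.1.1, z.2))))).
  have L1 D' : (forall z, D' z -> D z) -> cf D' [:: fun z => query z.1.1] (fun z => l1 z.1).
    move=> HD; apply: (cf_subst _ _ (fun z => z.1) _ _ _ H1) => [a /HD []//|].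
    by constructor=> //; exact: (cf_var 0).
  have L2 D' : (forall z, D' z -> D z) -> cf D' [:: fun z => query z.1.1]
      (fun z => l2 (z.1.1, z.2)).
    move=> HD; apply: (cf_subst _ _ (fun z => (z.1.1, z.2)) _ _ _ H2) => [a /HD []//|].
    by constructor=> //; exact: (cf_var 0).
  apply: (cf_guard _ _ (fun z => l1 z.1 * l2 (z.1.1, z.2))).
    by apply: (cf2 _ _ _ _ _ comp2_mul); [exact: L1|exact: L2].
  apply: (cf1 _ _ _ _ comp1S); apply: (cf2 _ _ _ _ _ Hh).
    by apply: (cf1 _ _ _ _ comp1_pred); apply: L1 => z [].
  by apply: (cf1 _ _ _ _ comp1_pred); apply: L2 => z [].
have {H} [c Hc] := H.
exists c => p q1 q2 T1 T2.
have [| |q [Hq Ha]] := tm_of_answers c p (fun n k =>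
  if l1 (n, p, k, q1) * l2 (n, p, k, q2) is 0 then 0
  else S (h (predn (l1 (n, p, k, q1))) (predn (l2 (n, p, k, q2))))).
- by move=> n k; apply: (Hc (n, p, k, q1, q2)).
- move=> n; exists (maxn (K1 p q1 n) (K2 p q2 n)); rewrite /l1 /l2 /=.
  by rewrite leq_maxl leq_maxr.
have <- // : q = (fun n => h (q1 n) (q2 n)).
apply: functional_extensionality => n; have [k] := Ha n; rewrite /l1 /l2 /=.
by case: leqP => _ //; case: leqP => _; rewrite ?muln0 // => -[].
Qed.

Lemma tm_map c h : comp1 h -> exists c', forall p q,
  tm_computes c p q -> tm_computes c' p (fun n => h (q n)).
Proof.
move=> Hh; have [|c' Hc'] := tm_pair c c (fun a _ => h a).
  by apply: (cf1 _ _ _ _ Hh); exact: (cf_var 0).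
by exists c' => p q T; apply: (Hc' p q q T T).
Qed.

(** Simulates a machine on a computed oracle: minimization finds the prefix length at which the
    latched machine answers, and one more call at that length reads the answer. *)
Lemma cf_run {A} c (D : A -> Prop) E (P : A -> nat -> nat) (I : A -> nat)
    (Q : A -> nat -> nat) :
  (forall a, D a -> tm_computes c (P a) (Q a)) ->
  cf D E I ->
  cf (fun z : A * nat => D z.1)
     ((fun z => z.2) :: List.map (fun e z => e z.1) E) (fun z => P z.1 z.2) ->
  cf D E (fun a => Q a (I a)).
Proof.
move=> HT HI HP; have [K HK] := cf_latch_fun c.
pose L (z : A * nat) :=
  if K (P z.1) (Q z.1) (I z.1) <= z.2 then S (Q z.1 (I z.1)) else 0.
have HL (D' : A * nat -> Prop) : (forall z, D' z -> D z.1) ->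
    cf D' ((fun z => z.2) :: List.map (fun e z => e z.1) E) L.
  move=> HD'.
  apply: (cf_subst _ _ (fun z => (I z.1, P z.1, z.2, Q z.1)) _ _ _ HK).
    by move=> z /HD' /HT.
  constructor=> //; apply: (cf2 _ _ _ _ _ comp2_cpair).
    exact: (cf_lift _ _ (fun z : A * nat => z.1) [:: _] _ _ HI).
  apply: (cf_code_prefix _ _ (fun z => P z.1)); first exact: (cf_var 0).
  apply: (cf_subst _ _ (fun z => (z.1.1, z.2)) _ _ _ HP).
    by move=> z [/HD' ? _].
  constructor; first exact: (cf_var 0).
  apply/List.Forall_map; rewrite /= List.map_map.
  exact: (cf_vars _ (fun z : A * nat * nat => z.1.1) [:: _; _]).
pose M a := K (P a) (Q a) (I a).
have HM : cf D E M.
  apply: (cf_mu _ _ (fun a k => 1 - L (a, k))).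
  - apply: (cf2 _ _ _ _ _ comp2_sub); first exact: cf_const.
    apply: (cf_ext _ (fun z : A * nat => D z.1) _ L); [exact: HL|by move=> z []|by case].
  - by move=> a _; rewrite /L /M /= leqnn; lia.
  - by move=> a k _ Hk; rewrite /L /= leqNgt Hk.
apply: (cf_ext _ D _ (fun a => predn (L (a, M a)))) => //; last first.
  by move=> a _; rewrite /L /M /= leqnn.
apply: (cf1 _ _ _ _ comp1_pred).
apply: (cf_subst _ (fun z : A * nat => D z.1) (fun a => (a, M a)) _ _ _ (HL _ (fun _ h => h))) => //.
constructor=> //; apply/List.Forall_map.
have := cf_vars D id nil E.
by have -> : [::] ++ List.map (fun e a => e (id a)) E = E by rewrite /= -[RHS]List.map_id.
Qed.

(** * Euclidean balls *)

Lemma fold_Rplus_ge0 {T} (g : T -> R) s :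
  (forall j, 0 <= g j)%R -> (0 <= List.fold_right Rplus 0 (List.map g s))%R.
Proof. move=> Hg; elim: s => [|j s IH] /=; [lra|have := Hg j; lra]. Qed.

Lemma fold_Rplus_term {T : eqType} (g : T -> R) i s :
  (forall j, 0 <= g j)%R -> i \in s -> (g i <= List.fold_right Rplus 0 (List.map g s))%R.
Proof.
move=> Hg; elim: s => [|j s IH] //=; rewrite inE => /orP [/eqP <-|/IH H].
- have := fold_Rplus_ge0 g s Hg; lra.
- have := Hg j; lra.
Qed.

Lemma fold_Rplus_single {T : eqType} (g : T -> R) i s :
  (forall j, j <> i -> g j = 0%R) -> uniq s -> i \in s ->
  List.fold_right Rplus 0%R (List.map g s) = g i.
Proof.
move=> Hg; elim: s => [|j s IH] //= /andP [Hj Hs]; rewrite inE.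
case: (i =P j) => [Ej _|Hij /= Hi]; last first.
  by rewrite (IH Hs Hi) (Hg j); [ring|move=> E; apply: Hij].
have -> : List.fold_right Rplus 0%R (List.map g s) = 0%R; last by rewrite -Ej; ring.
rewrite -Ej in Hj; elim: s Hj {Hs IH} => [|k s IH] //=; rewrite inE negb_or => /andP [Hk Hs].
by rewrite (IH Hs) (Hg k); [ring|move=> E; move/eqP: Hk; apply].
Qed.

Lemma dist2_coord {d} (x y : Vec d) i : ((x i - y i) ^ 2 <= dist2 x y)%R.
Proof.
apply: (fold_Rplus_term (fun j => ((x j - y j) ^ 2)%R)); last by rewrite mem_enum.
by move=> j; apply: pow2_ge_0.
Qed.

Lemma dist2_one_coord {d} (x y : Vec d) i :
  (forall j, j <> i -> x j = y j) -> dist2 x y = ((x i - y i) ^ 2)%R.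
Proof.
move=> H; apply: (fold_Rplus_single (fun j => ((x j - y j) ^ 2)%R)).
- by move=> j /H ->; ring.
- exact: enum_uniq.
- by rewrite mem_enum.
Qed.

Lemma vec1_eta (y : Vec 1) : y = fun _ => y ord0.
Proof. by apply: functional_extensionality => i; congr y; apply: val_inj; case: i => [[]]. Qed.

Lemma dist2_vec1 (x y : Vec 1) : dist2 x y = ((x ord0 - y ord0) ^ 2)%R.
Proof.
apply: dist2_one_coord => j []; apply: val_inj; by case: j => [[]].
Qed.

Lemma sqr_lt_abs a r : (0 < r)%R -> (a ^ 2 < r ^ 2)%R <-> (Rabs a < r)%R.
Proof. by move=> r0; split; rewrite /Rabs; case: Rcase_abs; nra. Qed.

Lemma in_ball_vec1 (c : Vec 1) r x :
  in_ball c r x <-> (0 < r /\ Rabs (x ord0 - c ord0) < r)%R.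
Proof.
by rewrite /in_ball dist2_vec1; split=> -[r0 H]; split=> //; apply/sqr_lt_abs.
Qed.

Lemma is_open_interval s t : is_open (fun y : Vec 1 => s < y ord0 < t)%R.
Proof.
move=> y Hy; exists (Rmin (y ord0 - s) (t - y ord0)).
have H1 := Rmin_l (y ord0 - s) (t - y ord0); have H2 := Rmin_r (y ord0 - s) (t - y ord0).
have H0 : (0 < Rmin (y ord0 - s) (t - y ord0))%R by apply: Rmin_pos; lra.
split=> // z /in_ball_vec1 [_]; rewrite /Rabs; case: Rcase_abs => ? ?; lra.
Qed.

(** * Components *)

(** The code of entry [i] in the vector coding of [qvec_of_nat], where pairs nest to the right. *)
Definition coord n i := (cunpair (Nat.iter i (fun m => (cunpair m).2) n)).1.

Lemma coord0 a b : coord (cpair a b) 0 = a.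
Proof. by rewrite /coord /= cunpair_cpair. Qed.

Lemma coordS a b i : coord (cpair a b) (S i) = coord b i.
Proof. by rewrite /coord Nat.iter_succ_r cunpair_cpair. Qed.

Lemma comp1_coord i : comp1 (fun n => coord n i).
Proof.
apply: (cf1 _ _ _ _ comp1_fst).
elim: i => [|i IH]; first exact: (cf_var 0).
exact: (cf1 _ _ _ _ comp1_snd IH).
Qed.

Lemma ball_of_nat_center d e i : fst (ball_of_nat d e) i = rval (coord (cunpair e).1 i).
Proof. by rewrite /ball_of_nat; case: (cunpair e). Qed.

Lemma ball_of_nat_radius d e : snd (ball_of_nat d e) = rval (cunpair e).2.
Proof. by rewrite /ball_of_nat; case: (cunpair e). Qed.

(** The inner 0 fills the tail of the nested pair that codes a vector of dimension 1. *)
Definition proj_ball i e := cpair (cpair (coord (cunpair e).1 i) 0) (cunpair e).2.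

Lemma comp1_proj_ball i : comp1 (proj_ball i).
Proof.
apply: (cf2 _ _ _ _ _ comp2_cpair); last exact: comp1_snd.
apply: (cf2 _ _ _ _ _ comp2_cpair); last exact: cf_const.
exact: (cf1 _ _ _ _ (comp1_coord i) comp1_fst).
Qed.

Definition update {d} (x : Vec d) (i : 'I_d) (r : R) : Vec d :=
  fun j => if j == i then r else x j.

Lemma in_ball_update {d} (c : Vec d) r i y :
  (0 < r)%R -> (Rabs (y - c i) < r)%R -> in_ball c r (update c i y).
Proof.
move=> r0 H; split=> //; rewrite (dist2_one_coord _ _ i).
  by rewrite /update eqxx; apply/sqr_lt_abs.
by move=> j /eqP/negbTE Hj; rewrite /update Hj.
Qed.

Lemma in_ball_coord {d} (c : Vec d) r x i : in_ball c r x -> (Rabs (x i - c i) < r)%R.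
Proof. move=> [r0 H]; apply/sqr_lt_abs => //; have := dist2_coord x c i; lra. Qed.

Lemma image_component {n m} (f : Vec n -> Vec m) U i y :
  image (component i f) U y <-> exists z, image f U z /\ z i = y ord0.
Proof.
split=> [[x [Ux <-]]|[_ [[x [Ux <-]] E]]]; first by exists (f x); split=> //; exists x.
by exists x; split=> //; rewrite [RHS]vec1_eta -E.
Qed.

Lemma continuous_on_component {n m} X (f : Vec n -> Vec m) i :
  continuous_on X f -> continuous_on X (component i f).
Proof.
move=> Hf x Xx eps Heps; have [delta [Hd H]] := Hf x Xx eps Heps.
exists delta; split=> // y Xy /(H y Xy); rewrite dist2_vec1 /component.
have := dist2_coord (f y) (f x) i; lra.
Qed.

(** Projection commutes with unions, so the name of the image is projected ball by ball; keeping the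
    radius keeps empty balls empty. *)
Lemma eff_open_on_component {n m} X (f : Vec n -> Vec m) i :
  eff_open_on X f -> eff_open_on X (component i f).
Proof.
move=> [Ho [c Hc]]; split.
  move=> U oU sU y /image_component [z [Iz Ez]].
  have [r [r0 Hr]] := Ho U oU sU z Iz; exists r; split=> // y' /in_ball_vec1 [_ Hy'].
  apply/image_component; exists (update z i (y' ord0)).
  split; last by rewrite /update eqxx.
  by apply/Hr/in_ball_update => //; rewrite Ez.
have [c' Hc'] := tm_map c _ (comp1_proj_ball i).
exists c' => U p oU sU Hp; have [q [Tq Hq]] := Hc U p oU sU Hp.
exists (fun k => proj_ball i (q k)); split; first exact: Hc'.
have E k y : in_ball (fst (ball_of_nat 1 (proj_ball i (q k))))
     (snd (ball_of_nat 1 (proj_ball i (q k)))) y <->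
   (0 < snd (ball_of_nat m (q k)) /\
    Rabs (y ord0 - fst (ball_of_nat m (q k)) i) < snd (ball_of_nat m (q k)))%R.
  by rewrite in_ball_vec1 !ball_of_nat_center !ball_of_nat_radius /proj_ball !cunpair_cpair coord0.
move=> y; split.
  move=> /image_component [z [/Hq [k Hk] Ez]]; exists k; apply/E.
  by rewrite -Ez; split; [case: Hk|exact: in_ball_coord].
move=> [k /E [r0 Hk]]; apply/image_component.
exists (update (fst (ball_of_nat m (q k))) i (y ord0)); split; last by rewrite /update eqxx.
by apply/Hq; exists k; exact: in_ball_update.
Qed.

Lemma computable_on_components {n m} X (f : Vec n -> Vec m) :
  (forall i, computable_on X (component i f)) -> computable_on X f.
Proof.
move=> Hf.
(* Vector codes nest to the right, so they are assembled from the last coordinate; [d] counts those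
   already present, with indices from [m - d] on. *)
suff H d : d <= m -> exists c, forall x, X x -> forall p, cauchy_name n p x ->
    exists q, tm_computes c p q /\ forall k (i : 'I_m), m - d <= i ->
      (Rabs (rval (coord (q k) (i - (m - d))) - f x i) <= / 2 ^ k)%R.
  have [c Hc] := H m (leqnn m); exists c => x Xx p Hp.
  have [q [Tq Hq]] := Hc x Xx p Hp; exists q; split=> // k i.
  by have := Hq k i; rewrite subnn subn0; apply.
elim: d => [|d IH] Hd.
  (* This code answers 1, meaning output 0, already on the empty prefix. *)
  exists (cComp cSucc [:: cZero]) => x _ p _; exists (fun _ => 0); split.
    move=> k; exists 0; split; last by move=> j /ltP.
    by apply: (eComp _ _ _ [:: 0]); [constructor; constructor|exact: eSucc].
  by move=> k i; have := ltn_ord i; lia.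
have Hi : m - S d < m by lia.
have [c1 H1] := Hf (Ordinal Hi); have [c2 H2] := IH (ltnW Hd).
have [|c Hc] := tm_pair c1 c2 (fun a b => cpair (cunpair a).1 b).
  apply: (cf2 _ _ _ _ _ comp2_cpair); last exact: (cf_var 1).
  by apply: (cf1 _ _ _ _ comp1_fst); exact: (cf_var 0).
exists c => x Xx p Hp.
have [q1 [T1 Hq1]] := H1 x Xx p Hp; have [q2 [T2 Hq2]] := H2 x Xx p Hp.
exists (fun k => cpair (cunpair (q1 k)).1 (q2 k)); split; first exact: Hc.
move=> k i Hmi; case: (ltngtP (m - S d) i) => Hid; last 2 first.
- by lia.
- rewrite Hid subnn coord0; have := Hq1 k ord0; rewrite /component.
  by have -> : Ordinal Hi = i by apply: val_inj.
have -> : i - (m - S d) = S (i - (m - d)) by lia.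
by rewrite coordS; apply: Hq2; lia.
Qed.

(** * The one-dimensional case *)

(** If [g x] exceeded both end values, the maximum over the closed interval would be attained
    inside, where openness yields a larger value. *)
Lemma open_map_no_interior_max (g : R -> R) s x t :
  (s < x < t)%R ->
  (forall y, s <= y <= t -> continuity_pt g y)%R ->
  (forall y, s < y < t -> exists eps, 0 < eps /\
     forall z, Rabs (z - g y) < eps -> exists y', s < y' < t /\ g y' = z)%R ->
  (g x <= g s \/ g x <= g t)%R.
Proof.
move=> Hx Hc Ho.
have [M [HM HMI]] := continuity_ab_maj g s t ltac:(lra) Hc.
have [//|Hs] := Rle_lt_dec (g x) (g s); first by left.
have [//|Ht] := Rle_lt_dec (g x) (g t); first by right.
have HMx := HM x ltac:(lra).
have Ms : M <> s by move=> E; rewrite E in HMx; lra.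
have Mt : M <> t by move=> E; rewrite E in HMx; lra.
have [eps [e0 He]] := Ho M ltac:(lra).
have [|y' [Hy' Ey']] := He (g M + eps / 2)%R.
  by rewrite Rabs_pos_eq; lra.
have := HM y' ltac:(lra); lra.
Qed.

Lemma open_map_between (g : R -> R) s x t :
  (s < x < t)%R ->
  (forall y, s <= y <= t -> continuity_pt g y)%R ->
  (forall y, s < y < t -> exists eps, 0 < eps /\
     forall z, Rabs (z - g y) < eps -> exists y', s < y' < t /\ g y' = z)%R ->
  (Rabs (g s - g x) <= Rabs (g s - g t))%R.
Proof.
move=> Hx Hc Ho.
have H1 := open_map_no_interior_max g s x t Hx Hc Ho.
have H2 : (- g x <= - g s \/ - g x <= - g t)%R.
  apply: (open_map_no_interior_max (fun y => - g y)%R s x t Hx).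
    by move=> y /Hc; apply: continuity_pt_opp.
  move=> y /Ho [eps [e0 He]]; exists eps; split=> // z Hz.
  have [|y' [Hy' E]] := He (- z)%R; last by exists y'; split=> //; lra.
  by rewrite -Rabs_Ropp; have -> : (- (- z - g y) = z - - g y)%R by ring.
by rewrite /Rabs; do 2 case: Rcase_abs => ?; lra.
Qed.

(** The margins [u < s] and [t < v] make [X] a neighbourhood of the closed interval from [s] to [t],
    so that continuity relative to [X] becomes two-sided continuity at the end points as well. *)
Lemma open_on_between (X : Vec 1 -> Prop) (f : Vec 1 -> Vec 1) (u v : R) (s x t : Vec 1) :
  (forall y : Vec 1, (u < y ord0 < v)%R -> X y) ->
  continuous_on X f -> open_on X f ->
  (u < s ord0 /\ s ord0 < x ord0 < t ord0 /\ t ord0 < v)%R ->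
  (Rabs (f s ord0 - f x ord0) <= Rabs (f s ord0 - f t ord0))%R.
Proof.
move=> HX Hf Ho [Hu [Hx Hv]].
pose g y := f (fun _ => y) ord0.
have E y : f y ord0 = g (y ord0) by rewrite /g -vec1_eta.
rewrite !E; apply: open_map_between => // y Hy.
  move=> eps e0.
  have [d [d0 Hd]] := Hf (fun _ => y) (HX (fun _ => y) ltac:(simpl; lra)) eps e0.
  (* Within distance [d1] of [y] a point stays between [u] and [v], hence in [X]. *)
  pose d1 := Rmin d (Rmin (y - u) (v - y)).
  have Hd1 := Rmin_l d (Rmin (y - u) (v - y)).
  have Hd2 := Rmin_r d (Rmin (y - u) (v - y)).
  have Hd3 := Rmin_l (y - u) (v - y); have Hd4 := Rmin_r (y - u) (v - y).
  exists d1; split; first by rewrite /d1; do 2 (apply: Rmin_pos; try lra).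
  move=> z [_ Hz]; rewrite /= /Rdist in Hz *.
  have Hz' : (u < z < v)%R.
    by move: Hz; rewrite /d1 /Rabs; case: Rcase_abs => ? ?; lra.
  have := Hd (fun _ => z) (HX (fun _ => z) Hz'); rewrite !dist2_vec1.
  move=> H; apply/sqr_lt_abs => //; apply: H; apply/sqr_lt_abs => //.
  rewrite /d1 in Hz; lra.
have sU : subset (fun w : Vec 1 => s ord0 < w ord0 < t ord0)%R X.
  by move=> w Hw; apply: HX; lra.
have [|r [r0 Hr]] := Ho _ (is_open_interval _ _) sU (f (fun _ => y)).
  by exists (fun _ => y); split.
exists r; split=> // z Hz; have [|w [Hw Ew]] := Hr (fun _ => z).
  by apply/in_ball_vec1.
by exists (w ord0); split=> //; rewrite -E Ew.
Qed.

(** * Rational intervals and names of their images *)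

Definition center e := rval (coord (cunpair e).1 0).
Definition radius e := rval (cunpair e).2.
Definition ball e : Vec 1 -> Prop :=
  in_ball (fst (ball_of_nat 1 e)) (snd (ball_of_nat 1 e)).

Lemma ballE e x : ball e x <-> (0 < radius e /\ Rabs (x ord0 - center e) < radius e)%R.
Proof. by rewrite /ball in_ball_vec1 ball_of_nat_center ball_of_nat_radius. Qed.

Lemma ball_center e : (0 < radius e)%R -> ball e (fun _ => center e).
Proof. by move=> r0; apply/ballE; rewrite Rminus_diag Rabs_R0. Qed.

Lemma is_open_ball e : is_open (ball e).
Proof.
move=> x /ballE [r0 Hx].
have [r [r1 Hr]] := is_open_interval (center e - radius e) (center e + radius e) x
  ltac:(move: Hx; rewrite /Rabs; case: Rcase_abs => ? ?; lra).
exists r; split=> // y /Hr Hy; apply/ballE; split=> //.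
by rewrite /Rabs; case: Rcase_abs => ?; lra.
Qed.

Lemma ball_subset e e' :
  (center e' - radius e' <= center e - radius e)%R ->
  (center e + radius e <= center e' + radius e')%R -> subset (ball e) (ball e').
Proof.
move=> H1 H2 x /ballE [r0 Hx]; apply/ballE; split; first by lra.
by move: Hx; rewrite /Rabs; do 2 case: Rcase_abs => ?; lra.
Qed.

Lemma cfR_center {A} (D : A -> Prop) E F : cf D E F -> cfR D E (fun a => center (F a)).
Proof.
move=> HF; apply: cfR_rval; apply: (cf1 (fun n => coord n 0)); first exact: comp1_coord.
exact: (cf1 _ _ _ _ comp1_fst).
Qed.

Lemma cfR_radius {A} (D : A -> Prop) E F : cf D E F -> cfR D E (fun a => radius (F a)).
Proof. by move=> HF; apply: cfR_rval; apply: (cf1 _ _ _ _ comp1_snd). Qed.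

Lemma ball_inside u v (x : R) : (u < x < v)%R -> exists e,
  (0 < radius e /\ u < center e - radius e /\ center e + radius e < v)%R.
Proof.
move=> Hx; have [a Ha] := rval_dense u v ltac:(lra).
have [b Hb] := rval_dense 0 (Rmin (rval a - u) (v - rval a)) ltac:(apply: Rmin_pos; lra).
exists (cpair (cpair a 0) b); rewrite /center /radius !cunpair_cpair coord0.
have := Rmin_l (rval a - u) (v - rval a); have := Rmin_r (rval a - u) (v - rval a).
move=> /=; lra.
Qed.

Lemma pow2_inv_small (g : R) : (0 < g)%R -> exists N, forall k, N <= k -> (/ 2 ^ k < g)%R.
Proof.
move=> g0; have [N [HN /ltP N0]] := archimed_cor1 g g0; exists N => k Hk.
apply: Rle_lt_trans HN; apply: Rinv_le_contravar; first exact/lt_0_INR/ltP.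
have H n : (INR n <= 2 ^ n)%R.
  elim: n => [|n IH]; first by rewrite /=; lra.
  rewrite S_INR /=; have : (1 <= 2 ^ n)%R by apply: pow_R1_Rle; lra.
  lra.
apply: Rle_trans (H k); exact/le_INR/leP.
Qed.

(** The constant sequence [e] is a name of [ball e], so the oracle of the machine for images is
    given by one number. [Q e] is arbitrary if [ball e] is not inside [X]. *)
Lemma image_names X (f : Vec 1 -> Vec 1) c :
  (forall U p, is_open U -> subset U X -> theta_name 1 p U ->
    exists q, tm_computes c p q /\ theta_name 1 q (image f U)) ->
  exists Q : nat -> nat -> nat, forall e, subset (ball e) X ->
    tm_computes c (fun _ => e) (Q e) /\ theta_name 1 (Q e) (image f (ball e)).
Proof.
move=> Hc.
pose good e q := tm_computes c (fun _ => e) q /\ theta_name 1 q (image f (ball e)).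
exists (fun e => epsilon (inhabits (fun _ => 0)) (good e)) => e He.
apply: (epsilon_spec (inhabits (fun _ : nat => 0)) (good e)).
apply: (Hc (ball e) (fun _ => e) (is_open_ball e) He) => x.
by split=> [Hx|[_]]; first exists 0.
Qed.

(** * The search for a certificate *)

Definition indicator {P Q : Prop} (b : {P} + {Q}) : nat := if b then 1 else 0.

Lemma indicator_neq0 {P Q} (b : {P} + {Q}) : indicator b <> 0 -> P.
Proof. by case: b. Qed.

Lemma indicator_true {P} (b : {P} + {~ P}) : P -> indicator b = 1.
Proof. by case: b. Qed.

Lemma mul_neq0 a b : a * b <> 0 -> a <> 0 /\ b <> 0.
Proof. by move=> H; split=> E; apply: H; rewrite E ?muln0. Qed.

(* A code [t] stands for a tuple [(j, (e1, (e2, (r1, r2))))]: an outer ball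
   [pX j], two balls [e1], [e2] inside it, and positions in the enumerations
   [Q e1], [Q e2] of their images. *)
Definition outer_ball (pX : nat -> nat) t := pX (cunpair t).1.
Definition left_ball t := (cunpair (cunpair t).2).1.
Definition right_ball t := (cunpair (cunpair (cunpair t).2).2).1.
Definition left_image (Q : nat -> nat -> nat) t :=
  Q (left_ball t) (cunpair (cunpair (cunpair (cunpair t).2).2).2).1.
Definition right_image (Q : nat -> nat -> nat) t :=
  Q (right_ball t) (cunpair (cunpair (cunpair (cunpair t).2).2).2).2.

(** Passing this test also makes it safe to run the machine for images on both inner balls. *)
Definition nested pX t : nat :=
  indicator (Rlt_dec 0 (radius (left_ball t))) * indicator (Rlt_dec 0 (radius (right_ball t))) *
  indicator (Rle_dec (center (outer_ball pX t) - radius (outer_ball pX t))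
                    (center (left_ball t) - radius (left_ball t))) *
  indicator (Rle_dec (center (left_ball t) + radius (left_ball t))
                    (center (right_ball t) - radius (right_ball t))) *
  indicator (Rle_dec (center (right_ball t) + radius (right_ball t))
                    (center (outer_ball pX t) + radius (outer_ball pX t))).

(** Here [x] is a rational approximation with error at most [eps]; the tolerance ensures that the
    true point lies between the two balls. *)
Definition separated t (x eps : R) : nat :=
  indicator (Rle_dec (center (left_ball t) + radius (left_ball t)) (x - eps)) *
  indicator (Rle_dec (x + eps) (center (right_ball t) - radius (right_ball t))).

(** A ball of positive radius contains its center, so the first two factors certify that both
    centers are values of [f]. *)
Definition close Q t n : nat :=
  indicator (Rlt_dec 0 (radius (left_image Q t))) *
  indicator (Rlt_dec 0 (radius (right_image Q t))) *
  indicator (Rle_dec (center (left_image Q t) - center (right_image Q t)) (/ 2 ^ n)) *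
  indicator (Rle_dec (center (right_image Q t) - center (left_image Q t)) (/ 2 ^ n)).

(* Stage [k] reads [t] off the first component of [k], so every [t] is tried
   with arbitrarily good approximations to [x]. *)
Definition answer pX Q (z : nat * (nat -> nat) * nat) : nat :=
  let t := (cunpair z.2).1 in
  if z.2 is 0 then 0 else
  if nested pX t * separated t (rval (coord (z.1.2 (predn z.2)) 0)) (/ 2 ^ predn z.2) is 0 then 0
  else if close Q t z.1.1 is 0 then 0 else S (cunpair (left_image Q t)).1.

Lemma nestedP pX t : nested pX t <> 0 <->
  (0 < radius (left_ball t) /\ 0 < radius (right_ball t) /\
   center (outer_ball pX t) - radius (outer_ball pX t)
     <= center (left_ball t) - radius (left_ball t) /\
   center (left_ball t) + radius (left_ball t) <= center (right_ball t) - radius (right_ball t) /\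
   center (right_ball t) + radius (right_ball t)
     <= center (outer_ball pX t) + radius (outer_ball pX t))%R.
Proof.
split=> [|[H1 [H2 [H3 [H4 H5]]]]]; last by rewrite /nested !indicator_true.
move=> /mul_neq0 [/mul_neq0 [/mul_neq0 [/mul_neq0 []]]].
by do 5 move=> /indicator_neq0 ?.
Qed.

Lemma separatedP t x eps : separated t x eps <> 0 <->
  (center (left_ball t) + radius (left_ball t) <= x - eps /\
   x + eps <= center (right_ball t) - radius (right_ball t))%R.
Proof.
split=> [|[H1 H2]]; last by rewrite /separated !indicator_true.
by move=> /mul_neq0 []; do 2 move=> /indicator_neq0 ?.
Qed.

Lemma closeP Q t n : close Q t n <> 0 <->
  (0 < radius (left_image Q t) /\ 0 < radius (right_image Q t) /\
   Rabs (center (left_image Q t) - center (right_image Q t)) <= / 2 ^ n)%R.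
Proof.
split=> [|[H1 [H2 H3]]].
  move=> /mul_neq0 [/mul_neq0 [/mul_neq0 []]].
  do 4 move=> /indicator_neq0 ?; split=> //; split=> //.
  by rewrite /Rabs; case: Rcase_abs; lra.
by rewrite /close !indicator_true //; move: H3; rewrite /Rabs; case: Rcase_abs; lra.
Qed.

Lemma answerP pX Q z : answer pX Q z <> 0 <->
  let t := (cunpair z.2).1 in
  z.2 <> 0 /\ nested pX t <> 0 /\
  separated t (rval (coord (z.1.2 (predn z.2)) 0)) (/ 2 ^ predn z.2) <> 0 /\
  close Q t z.1.1 <> 0.
Proof.
rewrite /answer; case: (z.2) => [|k]; first by split=> // -[].
set a := nested _ _; set b := separated _ _ _; set c := close _ _ _.
split=> [|[_ [Ha [Hb Hc]]]].
  case E : (a * b) => [|?] //; case E' : c => [|?] // _; split=> //.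
  have /mul_neq0 [] : a * b <> 0 by rewrite E.
  by [].
by case: a Ha => // a _; case: b Hb => // b _; case: c Hc.
Qed.

Lemma answer_value pX Q z : answer pX Q z <> 0 ->
  answer pX Q z = S (cunpair (left_image Q (cunpair z.2).1)).1.
Proof.
by rewrite /answer; case: z.2 => // k; case: (_ * _) => // ?; case: close.
Qed.

Lemma nested_subset pX t : nested pX t <> 0 ->
  subset (ball (left_ball t)) (ball (outer_ball pX t)) /\
  subset (ball (right_ball t)) (ball (outer_ball pX t)).
Proof.
by move=> /nestedP [? [? [? [? ?]]]]; split; apply: ball_subset; lra.
Qed.

(** Totality rests on the order of the guards: the prefix is known to be nonempty before its last
    entry is read, and both balls are known to lie in [X] before [c] is run on them. *)
Lemma cf_answer X c pX Q :
  computable_seq pX -> 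
  (forall x j, ball (pX j) x -> X x) ->
  (forall e, subset (ball e) X -> tm_computes c (fun _ => e) (Q e)) ->
  cf (fun _ => True) [:: query] (answer pX Q).
Proof.
move=> [cX HcX] HX HQ.
have cpX : comp1 pX by exists cX => a _; apply: HcX.
have Hk D : cf D [:: query] (fun z => z.2) := cf_query_length.
have Ht D : cf D [:: query] (fun z => (cunpair z.2).1) by apply: (cf1 _ _ _ _ comp1_fst).
have Hs h D : comp1 h -> cf D [:: query] (fun z => h (cunpair z.2).1).
  by move=> Hh; apply: (cf1 _ _ _ _ Hh).
have f1 h : comp1 h -> comp1 (fun n => (cunpair (h n)).1) := cf1 _ _ _ _ comp1_fst.
have f2 h : comp1 h -> comp1 (fun n => (cunpair (h n)).2) := cf1 _ _ _ _ comp1_snd.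
have fid : comp1 id by exact: (cf_var 0).
have HJ D : cf D [:: query] (fun z => outer_ball pX (cunpair z.2).1).
  by apply: (Hs _ _); apply: (cf1 _ _ _ _ cpX); apply f1.
have He1 D : cf D [:: query] (fun z => left_ball (cunpair z.2).1).
  by apply: (Hs _ _); apply f1; apply f2.
have He2 D : cf D [:: query] (fun z => right_ball (cunpair z.2).1).
  by apply: (Hs _ _); apply f1; do 2 apply f2.
apply: (cf_guard _ _ (fun z => z.2)) => //.
have Hx : cf (fun z => True /\ z.2 <> 0) [:: query] (fun z => z.1.2 (predn z.2)).
  apply: (cf_query_nth _ _ (fun z => z) (fun z => predn z.2)).
  - exact: (cf_var 0).
  - exact: (cf1 _ _ _ _ comp1_pred).
  - by move=> [? [|k]] [_ H] /=.
have mulc := cf2 _ _ _ _ _ comp2_mul.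
apply: (cf_guard _ _ (fun z => nested pX (cunpair z.2).1 *
   separated (cunpair z.2).1 (rval (coord (z.1.2 (predn z.2)) 0)) (/ 2 ^ predn z.2))).
  have Hxq : cfR (fun z => True /\ z.2 <> 0) [:: query]
      (fun z => rval (coord (z.1.2 (predn z.2)) 0)).
    apply: cfR_rval; apply: (cf1 (fun n => coord n 0)) => //; exact: comp1_coord.
  have Heps : cfR (fun z => True /\ z.2 <> 0) [:: query] (fun z => (/ 2 ^ predn z.2)%R).
    by apply: cfR_pow; apply: (cf1 _ _ _ _ comp1_pred).
  rewrite /nested /separated /indicator.
  repeat first [apply mulc | apply: cf_lt | apply: cf_le | exact: cfR_0 | assumption
    | apply: cfR_sub | apply: cfR_add | apply: cfR_center | apply: cfR_radius
    | apply HJ | apply He1 | apply He2].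
set D := (fun _ => _ /\ _).
have HD z : D z -> subset (ball (left_ball (cunpair z.2).1)) X /\
                  subset (ball (right_ball (cunpair z.2).1)) X.
  move=> [_ /mul_neq0 [/nested_subset [H1 H2] _]].
  by split=> x Hx'; [apply: (HX x) (H1 x Hx')|apply: (HX x) (H2 x Hx')].
have Hy1 D' : (forall z, D' z -> D z) -> cf D' [:: query] (fun z => left_image Q (cunpair z.2).1).
  move=> HD'; apply: (cf_run c _ _ (fun z _ => left_ball (cunpair z.2).1)
     (fun z => (cunpair (cunpair (cunpair (cunpair (cunpair z.2).1).2).2).2).1)
     (fun z => Q (left_ball (cunpair z.2).1))).
  - by move=> z /HD' /HD [? _]; apply: HQ.
  - by apply: (Hs (fun t => (cunpair (cunpair (cunpair (cunpair t).2).2).2).1));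
    apply f1; do 3 apply f2.
  - by apply: (cf_lift _ D' (fun z => z.1) [:: _] _ _ (He1 _)).
have Hy2 D' : (forall z, D' z -> D z) -> cf D' [:: query] (fun z => right_image Q (cunpair z.2).1).
  move=> HD'; apply: (cf_run c _ _ (fun z _ => right_ball (cunpair z.2).1)
     (fun z => (cunpair (cunpair (cunpair (cunpair (cunpair z.2).1).2).2).2).2)
     (fun z => Q (right_ball (cunpair z.2).1))).
  - by move=> z /HD' /HD [_ ?]; apply: HQ.
  - by apply: (Hs (fun t => (cunpair (cunpair (cunpair (cunpair t).2).2).2).2)); do 4 apply f2.
  - by apply: (cf_lift _ D' (fun z => z.1) [:: _] _ _ (He2 _)).
apply: (cf_guard _ _ (fun z => close Q (cunpair z.2).1 z.1.1)).
  rewrite /close /indicator.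
  have Hn : cf D [:: query] (fun z => z.1.1) := cf_query_index.
  repeat first [apply mulc | apply: cf_lt | apply: cf_le | exact: cfR_0 | assumption
    | apply: cfR_sub | apply: cfR_add | apply: cfR_center | apply: cfR_radius | apply: cfR_pow
    | apply Hy1 | apply Hy2] => //.
apply: (cf1 _ _ _ _ comp1S); apply: (cf1 _ _ _ _ comp1_fst).
by apply Hy1 => z [].
Qed.

(** * Soundness and termination of the search *)

Lemma certificate_sound X (f : Vec 1 -> Vec 1) pX Q x t n :
  continuous_on X f -> open_on X f -> (forall y j, ball (pX j) y -> X y) ->
  (forall e, subset (ball e) X -> theta_name 1 (Q e) (image f (ball e))) ->
  nested pX t <> 0 ->
  (center (left_ball t) + radius (left_ball t)
   <= x ord0 <= center (right_ball t) - radius (right_ball t))%R ->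
  close Q t n <> 0 -> (Rabs (center (left_image Q t) - f x ord0) <= / 2 ^ n)%R.
Proof.
move=> Hf Ho HX HQ Ht Hx /closeP [r1 [r2 Hcl]].
have [J1 J2] := nested_subset _ _ Ht.
(* Centers in the name of an image are attained, at points that are located only up to their ball;
   the order of the balls is all that is used of them. *)
have hit e r : subset (ball e) (ball (outer_ball pX t)) -> (0 < radius (Q e r))%R ->
    exists s, ball e s /\ center (Q e r) = f s ord0.
  move=> He Hr; have [s [Hs Es]] : image f (ball e) (fun _ => center (Q e r)).
    by apply/(HQ e (fun y Hy => HX y _ (He y Hy))); exists r; apply: ball_center.
  by exists s; split=> //; rewrite Es.
have [s [/ballE [_ Hs] Es]] := hit _ _ J1 r1.
have [u [/ballE [_ Hu] Eu]] := hit _ _ J2 r2.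
rewrite /left_image /right_image Es Eu in Hcl *.
apply: Rle_trans Hcl.
move/nestedP: Ht => [R1 [R2 [N1 [N2 N3]]]].
apply: (open_on_between X f (center (outer_ball pX t) - radius (outer_ball pX t))
          (center (outer_ball pX t) + radius (outer_ball pX t))) => //.
  move=> y Hy; apply: (HX y (cunpair t).1); apply/ballE; rewrite -/(outer_ball pX t).
  by split; [lra|rewrite /Rabs; case: Rcase_abs => ?; lra].
by move: Hs Hu; rewrite /Rabs; do 2 case: Rcase_abs => ?; lra.
Qed.

Lemma computable_of_eff_open X (f : Vec 1 -> Vec 1) :
  re_open 1 X -> continuous_on X f -> eff_open_on X f -> computable_on X f.
Proof.
move=> [pX [cX HX]] Hf [Ho [c Hc]].
have [Q HQ] := image_names X f c Hc.
have HXj x j : ball (pX j) x -> X x by move=> H; apply/HX; exists j.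
have [cA HA] := cf_answer X c pX Q cX HXj (fun e He => proj1 (HQ e He)).
exists cA => x Xx p Hp.
have Hpx k : (Rabs (rval (coord (p k) 0) - x ord0) <= / 2 ^ k)%R := Hp k ord0.
have [||q [Tq Hq]] := tm_of_answers cA p (fun n k => answer pX Q (n, p, k)).
- by move=> n k; apply: (HA (n, p, k)).
- move=> n.
  have [j Hj] : exists j, ball (pX j) x by apply/HX.
  have [r0 Hxj] := proj1 (ballE _ _) Hj.
  (* Two centers, each within half of [/ 2 ^ n] of [f x], pass the test [close]. *)
  have e0 : (0 < / 2 ^ n / 2)%R by have := Rinv_0_lt_compat _ (pow_lt 2 n ltac:(lra)); lra.
  have [d [d0 Hd]] := Hf x Xx _ e0.
  set J := pX j in Hj r0 Hxj.
  (* Between [lo] and [hi] points lie both in the outer ball [J] and within [d] of [x]. *)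
  pose lo := Rmax (center J - radius J) (x ord0 - d).
  pose hi := Rmin (center J + radius J) (x ord0 + d).
  have Hlo : (lo < x ord0)%R.
    by apply: Rmax_lub_lt; move: Hxj; rewrite /Rabs; case: Rcase_abs; lra.
  have Hhi : (x ord0 < hi)%R.
    by apply: Rmin_glb_lt; move: Hxj; rewrite /Rabs; case: Rcase_abs; lra.
  have [e1 [r1 [L1 U1]]] := ball_inside lo (x ord0) ((lo + x ord0) / 2) ltac:(lra).
  have [e2 [r2 [L2 U2]]] := ball_inside (x ord0) hi ((hi + x ord0) / 2) ltac:(lra).
  have lo1 : (center J - radius J <= lo)%R by apply: Rmax_l.
  have lo2 : (x ord0 - d <= lo)%R by apply: Rmax_r.
  have hi1 : (hi <= center J + radius J)%R by apply: Rmin_l.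
  have hi2 : (hi <= x ord0 + d)%R by apply: Rmin_r.
  have near e : (0 < radius e -> lo <= center e - radius e -> center e + radius e <= hi ->
      exists r, 0 < radius (Q e r) /\ Rabs (center (Q e r) - f x ord0) < / 2 ^ n / 2)%R.
    move=> re Le Ue.
    have He : subset (ball e) X.
      by move=> y Hy; apply: (HXj y j); apply: ball_subset Hy; rewrite -/J; lra.
    have [_ Qe] := HQ e He.
    have [r /ballE [rr _]] : exists r, ball (Q e r) (f (fun _ => center e)).
      by apply/Qe; exists (fun _ => center e); split=> //; apply: ball_center.
    exists r; split=> //.
    have [y [Hy Ey]] : image f (ball e) (fun _ => center (Q e r)).
      by apply/Qe; exists r; apply: ball_center.
    have -> : center (Q e r) = f y ord0 by rewrite Ey.
    apply/sqr_lt_abs => //; rewrite -dist2_vec1; apply: Hd; first exact: He.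
    rewrite dist2_vec1; apply/sqr_lt_abs => //.
    move/ballE: Hy => [_]; by rewrite /Rabs; do 2 case: Rcase_abs => ?; lra.
  have [s1 [R1 C1]] := near e1 r1 ltac:(lra) ltac:(lra).
  have [s2 [R2 C2]] := near e2 r2 ltac:(lra) ltac:(lra).
  pose t := cpair j (cpair e1 (cpair e2 (cpair s1 s2))).
  (* Half the gap, because the error of the approximation to [x] and the tolerance in [separated]
     each cost [/ 2 ^ k]. *)
  have [N HN] := pow2_inv_small
    (Rmin (x ord0 - (center e1 + radius e1)) (center e2 - radius e2 - x ord0) / 2)
    ltac:(apply: Rdiv_lt_0_compat; last lra; apply: Rmin_pos; lra).
  (* Pairing [t] with [S N] yields a stage that is at least [S N], so the last entry of the prefix
     has index at least [N]. *)
  exists (cpair t (S N)); apply/answerP; rewrite /= cunpair_cpair [(t, _).1]/=.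
  have Hk : S N <= cpair t (S N) by rewrite cpairE; lia.
  have := HN (predn (cpair t (S N))) ltac:(lia).
  have := Hpx (predn (cpair t (S N))).
  set k := predn _; set gap := Rmin _ _; set xk := rval _ => Hxk Hgap.
  have gap1 : (gap <= x ord0 - (center e1 + radius e1))%R by apply: Rmin_l.
  have gap2 : (gap <= center e2 - radius e2 - x ord0)%R by apply: Rmin_r.
  have [Ej [E1 [E2 [Ey1 Ey2]]]] :
      outer_ball pX t = J /\ left_ball t = e1 /\ right_ball t = e2 /\
      left_image Q t = Q e1 s1 /\ right_image Q t = Q e2 s2.
    rewrite /outer_ball /left_image /right_image /left_ball /right_ball /t.
    by do 5 (rewrite ?cunpair_cpair /=).
  split; first by lia.
  split; first by apply/nestedP; rewrite Ej E1 E2; lra.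
  split.
    apply/separatedP; rewrite E1 E2.
    by move: Hxk; rewrite /Rabs; case: Rcase_abs; lra.
  apply/closeP; rewrite Ey1 Ey2; split=> //; split=> //.
  by move: C1 C2; rewrite /Rabs; do 3 case: Rcase_abs => ?; lra.
exists q; split=> // n i.
have [k Ek] := Hq n.
have Ak : answer pX Q (n, p, k) <> 0 by rewrite Ek.
have := answer_value _ _ _ Ak; rewrite Ek => -[->].
have [K0 [Hn [/separatedP [S1 S2] Hcl]]] := proj1 (answerP _ _ _) Ak.
have -> : i = ord0 by apply: val_inj; case: i => [[]].
apply: (certificate_sound X f pX Q x (cunpair k).1) => //.
- by move=> e /HQ [].
- by move: S1 S2 (Hpx (predn k)); rewrite /= /Rabs; case: Rcase_abs; lra.
Qed.

Theorem theorem6 :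
  (forall (X : Vec 1 -> Prop) (f : Vec 1 -> Vec 1),
      re_open 1 X -> continuous_on X f -> eff_open_on X f ->
      computable_on X f)
  /\
  (forall (n m : nat) (X : Vec n -> Prop) (f : Vec n -> Vec m),
      re_open n X -> continuous_on X f -> eff_open_on X f ->
      ~ computable_on X f ->
      exists i : 'I_m,
        continuous_on X (component i f) /\ eff_open_on X (component i f) /\
        ~ computable_on X (component i f)).
Proof.
split; first exact: computable_of_eff_open.
move=> n m X f _ Hc Ho Hn.
have [//|H] := classic (exists i : 'I_m, ~ computable_on X (component i f)).
  case=> i Hi; exists i; split; first exact: continuous_on_component.
  by split; first exact: eff_open_on_component.
case: Hn; apply: computable_on_components => i.
by apply: NNPP => Hi; apply: H; exists i.
Qed.
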